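(* Let $M$ be a finite $A$-generated inverse monoid and let $Q$ be a finite $A$-generated group such that, for all $w\in\widetilde A^*$, $[w]_Q=1_Q$ implies that $[w]_M$ is an idempotent of $M$. Let $E=Q\times A$, let $G$ be a finite $E$-generated group (with content function $\mathrm C$) which reflects the structure of the Cayley graph $\mathcal Q$ of $Q$, and let $H$ be the $A$-generated subgroup $$H:=\langle([(1_Q,a)]_G,[a]_Q)\colon a\in A\rangle\subseteq G\rtimes Q$$ of the semidirect product $G\rtimes Q$. Then $$S:=\{([w]_H,[w]_M)\colon w\in\widetilde A^*\}\subseteq H\times M$$ is a finite $F$-inverse cover of $M$.
   Context: Words: for a non-empty set $X$, $X^{-1}$ is a disjoint copy of formal inverses, $\widetilde X=X\cup X^{-1}$, with involution $(x^{-1})^{-1}=x$; $\widetilde X^*$ is the free monoid over $\widetilde X$ with $(x_1\cdots x_n)^{-1}=x_n^{-1}\cdots x_1^{-1}$. Inverse monoids: a monoid $M$ is inverse if every $x$ has a unique $x^{-1}$ with $xx^{-1}x=x$, $x^{-1}xx^{-1}=x^{-1}$. Natural order: $x\le y$ iff $x=ye$ for some idempotent $e$. The least group congruence $\sigma$: $x\mathrel\sigma y$ iff $xe=ye$ for some idempotent $e$. An inverse monoid is $F$-inverse if every $\sigma$-class has a greatest element w.r.t. $\le$. An $F$-inverse monoid $S$ is an $F$-inverse cover of $M$ if there is a surjective homomorphism $S\to M$ that is injective on idempotents (idempotent separating). $A$-generated structures: $A$ is a fixed non-empty set. An inverse monoid (in particular, a group) $M$ is $A$-generated if it is equipped with a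 (not necessarily injective) map $i_M\colon A\to M$ whose image generates $M$ as an inverse monoid. This map extends uniquely to a homomorphism of involutory monoids $w\mapsto[w]_M$, $\widetilde A^*\to M$. In $H$, the letter $a\in A$ is assigned the value $([(1_Q,a)]_G,[a]_Q)$. Cayley graph: $\mathcal Q$ has vertex set $Q$ and edge set $Q\times\widetilde A$; the edge $(g,a)$ has initial vertex $g$, terminal vertex $g[a]_Q$, and inverse edge $(g,a)^{-1}=(g[a]_Q,a^{-1})$. The positive edges form $E=Q\times A$, and the edge set of $\mathcal Q$ is identified with $\widetilde E=E\cup E^{-1}$. $Q$ acts on vertices and edges by left multiplication: ${}^hg=hg$, ${}^h(g,a)=(hg,a)$. A word $p\in\widetilde E^*$ forms a path $g\longrightarrow h$ in $\mathcal Q$ if, as a sequence of edges, it is a path (consecutive edges) from vertex $g$ to vertex $h$; the empty word forms the empty path at any vertex. Content function: an $X$-generated group $R$ has a content function $\mathrm C$ if for every $g\in R$ there is a unique $\subseteq$-minimal subset $\mathrm C(g)\subseteq X$ such that $g$ is a product of elements of $\mathrm C(g)$ and their inverses. An $E$-generated group $G$ reflects the structure of $\mathcal Q$ if: (1) the action of $Q$ on $E$ by left multiplication extends to an action of $Q$ on $G$ by automorphisms on the left, denoted $(g,\xi)\mapsto{}^g\xi$ (so ${}^g[e]_G=[{}^ge]_G$ for $e\in E$); (2) $G$ has a content function $\mathrm C$ such that for any word $p\in\widetilde E^*$ which forms a path $g\longrightarrow h$ in $\mathcal Q$: (a) if $\mathrm C([p]_G)=\varnothing$, i.e. $[p]_G=1$,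 then $g=h$; (b) if $\mathrm C([p]_G)\ne\varnothing$, then there is a word $q\in\widetilde E^*$ which also forms a path $g\longrightarrow h$ in $\mathcal Q$, with $[p]_G=[q]_G$, and which uses only edges of $\mathrm C([p]_G)$ and their inverses. The semidirect product $G\rtimes Q$ is the set $G\times Q$ with multiplication $(\gamma,g)(\eta,h)=(\gamma\cdot{}^g\eta,gh)$. *)

(* Defs.v *)
From HB Require Import structures.
From mathcomp Require Import all_boot all_fingroup.
From mathcomp Require Import boolp classical_sets cardinality.

Set Implicit Arguments.
Unset Strict Implicit.
Unset Printing Implicit Defensive.

Local Open Scope group_scope.

Variant letter (X : Type) : Type := Pos of X | Neg of X.

Definition letter_inv (X : Type) (l : letter X) : letter X :=
  match l with Pos x => Neg x | Neg x => Pos x end.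

Definition letter_base (X : Type) (l : letter X) : X :=
  match l with Pos x => x | Neg x => x end.

Definition word (X : Type) : Type := seq (letter X).

Definition letter_val (X : Type) (M : starMonoidType) (i : X -> M)
    (l : letter X) : M :=
  match l with Pos x => i x | Neg x => (i x)^-1 end.

Definition word_val (X : Type) (M : starMonoidType) (i : X -> M)
    (w : word X) : M :=
  \prod_(l <- w) letter_val i l.

Definition word_over (X : Type) (B : set X) (w : word X) : bool :=
  all (fun l => letter_base l \in B) w.

Definition inverse_of (M : monoidType) (x y : M) : Prop :=
  x * y * x = x /\ y * x * y = y.

Definition inverse_monoid (M : monoidType) : Prop :=
  forall x : M, exists! y : M, inverse_of x y.

(* In an inverse monoid the map sending x to its unique inverse is an involutive
   anti-automorphism; hence an inverse monoid is the same thing as a star-monoid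
   with the property below. *)
Definition inverse_star_monoid (M : starMonoidType) : Prop :=
  inverse_monoid M /\ forall x : M, inverse_of x x^-1.

Definition idem (M : monoidType) (x : M) : Prop := x * x = x.

Definition natural_le (M : monoidType) (x y : M) : Prop :=
  exists2 e : M, idem e & x = y * e.

Definition sigma (M : monoidType) (x y : M) : Prop :=
  exists2 e : M, idem e & x * e = y * e.

Definition F_inverse (M : monoidType) : Prop :=
  inverse_monoid M /\
  forall x : M, exists2 m : M, sigma x m &
    forall y : M, sigma x y -> natural_le y m.

Definition F_inverse_cover (S M : monoidType) : Prop :=
  F_inverse S /\
  exists f : UMagmaMorphism.type S M,
    (forall y : M, exists x : S, f x = y) /\
    (forall e e' : S, idem e -> idem e' -> f e = f e' -> e = e').

Definition generates (X : Type) (M : starMonoidType) (i : X -> M) : Prop :=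
  forall P : set M,
    P 1 -> (forall x y, P x -> P y -> P (x * y)) ->
    (forall x, P x -> P x^-1) -> (forall a, P (i a)) ->
    forall x, P x.

Definition supports (X : Type) (R : groupType) (i : X -> R) (g : R)
    (B : set X) : Prop :=
  exists2 w : word X, word_over B w & word_val i w = g.

Definition min_support (X : Type) (R : groupType) (i : X -> R) (g : R)
    (B : set X) : Prop :=
  supports i g B /\
  forall B' : set X, supports i g B' -> (B' `<=` B)%classic -> B' = B.

Definition content_function (X : Type) (R : groupType) (i : X -> R)
    (C : R -> set X) : Prop :=
  forall g : R, min_support i g (C g) /\
    forall B : set X, min_support i g B -> B = C g.

Section Cayley.
Variables (A : Type) (Q : groupType) (iQ : A -> Q).

(* Edges of the Cayley graph are the elements of Q * letter A. *)
Definition edge_init (e : Q * letter A) : Q := e.1.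

Definition edge_term (e : Q * letter A) : Q := e.1 * letter_val iQ e.2.

Definition edge_inv (e : Q * letter A) : Q * letter A :=
  (edge_term e, letter_inv e.2).

(* The identification of the formal inverses of positive edges with the
   inverse edges of the graph. *)
Definition edge_of (l : letter (Q * A)) : Q * letter A :=
  match l with
  | Pos e => (e.1, Pos e.2)
  | Neg e => edge_inv (e.1, Pos e.2)
  end.

Fixpoint forms_path (g : Q) (p : word (Q * A)) (h : Q) : Prop :=
  match p with
  | [::] => g = h
  | l :: p' => edge_init (edge_of l) = g /\ forms_path (edge_term (edge_of l)) p' h
  end.

End Cayley.

(* Left actions by automorphisms and the associated semidirect product; the
   library's groupAction and sdprod_by are right actions. *)

Record left_action (Q G : groupType) := LeftAction {
  lact :> Q -> G -> G;
  lact1 : forall x, lact 1 x = x;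
  lactM : forall g h x, lact (g * h) x = lact g (lact h x);
  lact_morph : forall g x y, lact g (x * y) = lact g x * lact g y
}.

Record reflects (A : Type) (Q G : groupType) (iQ : A -> Q) (iG : Q * A -> G)
    (act : left_action Q G) (C : G -> set (Q * A)) : Prop := Reflects {
  reflects_act : forall (h : Q) (e : Q * A), act h (iG e) = iG (h * e.1, e.2);
  reflects_content : content_function iG C;
  reflects_empty : forall (g h : Q) (p : word (Q * A)),
    forms_path iQ g p h -> C (word_val iG p) = set0 -> g = h;
  reflects_nonempty : forall (g h : Q) (p : word (Q * A)),
    forms_path iQ g p h -> C (word_val iG p) <> set0 ->
    exists q : word (Q * A),
      [/\ forms_path iQ g q h, word_val iG p = word_val iG q
        & word_over (C (word_val iG p)) q]
}.

Definition semidirect (Q G : finGroupType) (act : left_action Q G) : Type :=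
  (G * Q)%type.

Section Semidirect.
Variables (Q G : finGroupType) (act : left_action Q G).
Local Notation T := (semidirect act).

Definition semidirect_mul (x y : T) : T := (x.1 * act x.2 y.1, x.2 * y.2).
Definition semidirect_one : T := (1, 1).
Definition semidirect_inv (x : T) : T := (act x.2^-1 x.1^-1, x.2^-1).

Lemma lact_1 g : act g 1 = 1.
Proof. by apply: (mulgI (act g 1)); rewrite -lact_morph !mulg1. Qed.

Lemma semidirect_mulA : associative semidirect_mul.
Proof.
by move=> x y z; rewrite /semidirect_mul /= lact_morph lactM !mulgA.
Qed.

Lemma semidirect_mul1 : left_id semidirect_one semidirect_mul.
Proof. by move=> [x g]; rewrite /semidirect_mul /= lact1 !mul1g. Qed.

Lemma semidirect_mulV :
  left_inverse semidirect_one semidirect_inv semidirect_mul.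
Proof.
by move=> x; rewrite /semidirect_mul /= -lact_morph !mulVg lact_1.
Qed.

HB.instance Definition _ := Finite.copy T (G * Q)%type.
HB.instance Definition _ :=
  Finite_isGroup.Build T semidirect_mulA semidirect_mul1 semidirect_mulV.

End Semidirect.

Section Cover.
Variables (A : Type) (M : finStarMonoidType) (Q G : finGroupType).
Variables (iM : A -> M) (iQ : A -> Q) (iG : Q * A -> G).
Variable act : left_action Q G.

Definition gen_val (a : A) : semidirect act := (iG (1, a), iQ a).

Definition subH : {group semidirect act} :=
  <<[set x : semidirect act in range gen_val]>>%G.

Lemma gen_val_in a : gen_val a \in subH.
Proof. by apply: mem_gen; rewrite inE; apply/mem_set; exists a. Qed.

Definition iH (a : A) : [subg subH] := Subg (gen_val_in a).

Definition subS : set ([subg subH] * M) :=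
  [set (word_val iH w, word_val iM w) | w in [set: word A]]%classic.

Definition coverS : Type := {u : [subg subH] * M | u \in subS}.

Lemma subS_closed : umagma_closed (mem subS).
Proof.
split; first by apply/mem_set; exists [::] => //; rewrite /word_val !big_nil.
move=> _ _ /set_mem[w _ <-] /set_mem[v _ <-].
by apply/mem_set; exists (w ++ v) => //; rewrite /word_val !big_cat.
Qed.

HB.instance Definition _ := SubType.copy coverS {u | u \in subS}.
HB.instance Definition _ := [Choice of coverS by <:].
HB.instance Definition _ :=
  SubChoice_isSubMonoid.Build _ (mem subS) coverS subS_closed.

End Cover.

Arguments subS {A M Q G} iM iQ iG act _.
Arguments coverS {A M Q G} iM iQ iG act.

(* Main.v *)
(** Words v and w with the same value in H lift to paths from 1 in the Cayley
    graph of Q with the same value in G, hence with the same content.  The lift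
    of any such v uses every edge of the content, whereas reflection provides a
    w whose lift uses no other edges.  Inside M, right multiplication by the
    letters of w then moves [v v^-1] among the elements [v v^-1 u], u a prefix
    of v; since words of value 1 in Q are idempotent in M, such an element
    depends only on the vertex of the Cayley graph reached by u.  Therefore
    [v] = [v v^-1 w] <= [w], so that w gives the greatest element of the
    sigma-class, which is the set of elements of S with a given H-component. *)
Require Import Defs.
From HB Require Import structures.
From mathcomp Require Import all_boot all_fingroup.
From mathcomp Require Import boolp classical_sets cardinality.

Set Implicit Arguments.
Unset Strict Implicit.
Unset Printing Implicit Defensive.

Local Open Scope group_scope.

(** * Values of words and formal inverses *)

Section Words.
Variables (X : Type) (M : starMonoidType) (i : X -> M).

Lemma word_val_nil : word_val i [::] = 1.
Proof. by rewrite /word_val big_nil. Qed.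

Lemma word_val_cons l w : word_val i (l :: w) = letter_val i l * word_val i w.
Proof. by rewrite /word_val big_cons. Qed.

Lemma word_val_cat u w : word_val i (u ++ w) = word_val i u * word_val i w.
Proof. by rewrite /word_val big_cat. Qed.

Lemma word_val_rcons w l :
  word_val i (rcons w l) = word_val i w * letter_val i l.
Proof. by rewrite -cats1 word_val_cat word_val_cons word_val_nil mulg1. Qed.

Definition word_inv (w : word X) : word X := rev (map (@letter_inv X) w).

Lemma word_val_inv w : word_val i (word_inv w) = (word_val i w)^-1.
Proof.
rewrite /word_inv; elim: w => [|l w IH] /=; first by rewrite word_val_nil invg1.
rewrite rev_cons word_val_rcons IH word_val_cons invgM; congr (_ * _).
by case: l => x //=; rewrite invgK.
Qed.

Lemma generates_word_val : generates i -> forall x, exists w, word_val i w = x.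
Proof.
move=> gen_i; apply: gen_i => [|_ _ [u <-] [w <-]|_ [w <-]|a].
- by exists [::]; apply: word_val_nil.
- by exists (u ++ w); apply: word_val_cat.
- by exists (word_inv w); apply: word_val_inv.
- by exists [:: Pos a]; rewrite word_val_cons word_val_nil mulg1.
Qed.

End Words.

Lemma word_over_sub (X : Type) (B B' : set X) (w : word X) :
  (B `<=` B')%classic -> word_over B w -> word_over B' w.
Proof. by move=> sBB'; apply: sub_all => l /set_mem/sBB'/mem_set. Qed.

(** * Idempotents of an inverse monoid *)

Section InverseMonoid.
Variables (M : starMonoidType) (invM : inverse_star_monoid M).
Implicit Types e f x y : M.

Lemma mulgVg x : x * x^-1 * x = x.
Proof. by case: (invM.2 x). Qed.

Lemma inverse_of_uniq x y z : inverse_of x y -> inverse_of x z -> y = z.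
Proof. by case: (invM.1 x) => t [_ Ut] /Ut <- /Ut <-. Qed.

Lemma idem_inverse_of e : idem e -> inverse_of e e.
Proof. by rewrite /inverse_of /idem => ee; rewrite !ee. Qed.

Lemma idem_mulgV x : idem (x * x^-1).
Proof. by rewrite /idem mulgA mulgVg. Qed.

Lemma idem_mulVg x : idem (x^-1 * x).
Proof. by rewrite /idem -!mulgA (mulgA x) mulgVg. Qed.

(** The inverse [x] of [e * f] equals [f * x * e], which is idempotent and hence its own inverse; so
    [e * f = x]. *)
Lemma idemM e f : idem e -> idem f -> idem (e * f).
Proof.
move=> ee ff; set x := (e * f)^-1; have [xP1 xP2] := invM.2 (e * f).
rewrite -/x !mulgA in xP1 xP2.
have fxeP : inverse_of (e * f) (f * x * e).
  split; rewrite !mulgA.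
    by rewrite -(mulgA e f f) ff -(mulgA _ e e) ee.
  rewrite -(mulgA _ e e) ee -(mulgA _ f f) ff.
  by rewrite -!mulgA; congr (f * _); rewrite !mulgA xP2.
have xE : x = f * x * e by apply: inverse_of_uniq fxeP; apply: invM.2.
have xx : idem x.
  rewrite /idem xE -!mulgA; congr (f * _).
  by rewrite !mulgA xP2.
have -> // : e * f = x.
apply: (@inverse_of_uniq x); last exact: idem_inverse_of.
by have [] := invM.2 (e * f).
Qed.

(** By [idemM], both [e * f] and [f * e] are inverses of [e * f]. *)
Lemma idemC e f : idem e -> idem f -> e * f = f * e.
Proof.
move=> ee ff; apply: (@inverse_of_uniq (e * f)).
  exact/idem_inverse_of/idemM.
have absorb (a b : M) : idem a -> idem b -> a * b * (b * a) * (a * b) = a * b.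
  move=> aa bb; rewrite !mulgA -(mulgA a b b) bb -(mulgA _ a a) aa.
  by have := idemM aa bb; rewrite /idem !mulgA.
by split; apply: absorb.
Qed.

Lemma idemV e : idem e -> e^-1 = e.
Proof.
by move=> ee; apply: inverse_of_uniq (invM.2 e) (idem_inverse_of ee).
Qed.

Lemma idem_conj e x : idem e -> idem (x^-1 * e * x).
Proof.
move=> ee; rewrite /idem -!mulgA; congr (_ * _).
rewrite (mulgA x) (mulgA (x * x^-1)) (idemC (idem_mulgV x) ee).
by rewrite -(mulgA e) mulgVg mulgA ee.
Qed.

Lemma idem_mulg_conj e x : idem e -> e * x = x * (x^-1 * e * x).
Proof.
by move=> ee; rewrite !mulgA (idemC (idem_mulgV x) ee) -!mulgA (mulgA x) mulgVg.
Qed.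

Lemma quo_idemV x y : idem (x^-1 * y) -> y^-1 * x = x^-1 * y.
Proof. by move=> xy_idem; rewrite -(idemV xy_idem) invgM invgK. Qed.

Lemma quo_idem_eq x y : idem (x^-1 * y) -> x * (x^-1 * y) = y * (x^-1 * y).
Proof.
move=> xy_idem; rewrite mulgA (idem_mulg_conj _ (idem_mulgV x)).
by rewrite (mulgA y^-1) -(mulgA _ x^-1) (quo_idemV xy_idem) xy_idem.
Qed.

(** [y^-1 * x] and [x^-1 * y] are one idempotent [f], so [e * x = e * y * f] and
    [e * y = e * x * f]. *)
Lemma mulg_quo_idem e x y : idem e ->
  e * (x * x^-1) = e -> e * (y * y^-1) = e -> idem (x^-1 * y) -> e * x = e * y.
Proof.
move=> ee ex ey xy_idem.
have yxE := quo_idemV xy_idem.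
have eyE : e * x = e * y * (x^-1 * y) by rewrite -yxE -{1}ey !mulgA.
have exE : e * y = e * x * (x^-1 * y) by rewrite -{1}ex !mulgA.
by rewrite eyE exE -(mulgA (e * x)) xy_idem.
Qed.

(** Commuting [y * y^-1] with [x^-1 * x] lets the last factor be undone; this will make edges
    reversible. *)
Lemma mulgKV_le e x y :
  e * ((x * y) * (x * y)^-1) = e -> e * x * y * y^-1 = e * x.
Proof.
move=> exy; rewrite -[in RHS]exy -!mulgA; congr (_ * _).
rewrite invgM -!mulgA (mulgA y) (idemC (idem_mulgV y) (idem_mulVg x)).
by rewrite !mulgA mulgVg.
Qed.

End InverseMonoid.

(** * Lifting words to paths in the Cayley graph *)

Section Lift.
Variables (A : Type) (Q : groupType) (iQ : A -> Q).
Implicit Types (g h : Q) (w : word A) (p : word (Q * A)).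

(* The edge (g, a^-1) is the formal inverse of the positive edge ending at g. *)
Fixpoint lift g w : word (Q * A) :=
  match w with
  | [::] => [::]
  | Pos a :: w' => Pos (g, a) :: lift (g * iQ a) w'
  | Neg a :: w' => Neg (g * (iQ a)^-1, a) :: lift (g * (iQ a)^-1) w'
  end.

Definition label (l : letter (Q * A)) : letter A :=
  match l with Pos e => Pos e.2 | Neg e => Neg e.2 end.

Lemma lift_path g w : forms_path iQ g (lift g w) (g * word_val iQ w).
Proof.
elim: w g => [|[a|a] w IH] g /=; first by rewrite word_val_nil mulg1.
  by split=> //; rewrite word_val_cons mulgA; apply: IH.
rewrite word_val_cons /edge_init /edge_term /= mulgA /edge_term /= mulgKV.
by split=> //; apply: IH.
Qed.

(** Turns the path supplied by reflection into the lift of a word over [A]. *)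
Lemma path_lift g p h : forms_path iQ g p h ->
  lift g (map label p) = p /\ h = g * word_val iQ (map label p).
Proof.
elim: p g => [|l p IH] g /=; first by move<-; rewrite word_val_nil mulg1.
by case: l => [[k a]|[k a]] /= [<- /IH [pE ->]];
  rewrite /edge_init /edge_term /= word_val_cons !mulgA;
  split=> //; congr (_ :: _); rewrite ?mulgK // /edge_term /= mulgK in pE *.
Qed.

End Lift.

(** * Right multiplication along paths through the prefixes of [v] *)

Section Prefixes.
Variables (A : Type) (M : starMonoidType) (invM : inverse_star_monoid M).
Variables (iM : A -> M) (Q : groupType) (iQ : A -> Q).
Hypothesis hQM : forall w : word A, word_val iQ w = 1 -> idem (word_val iM w).
Variable v : word A.
Local Notation dom_v := (word_val iM v * (word_val iM v)^-1).

Definition reached (k : Q) (x : M) : Prop :=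
  exists u u', [/\ v = u ++ u', word_val iQ u = k & dom_v * word_val iM u = x].

Definition spanned : set (Q * A) := fun b =>
  exists x y, [/\ reached b.1 x, reached (b.1 * iQ b.2) y,
                  x * iM b.2 = y & y * (iM b.2)^-1 = x].

Lemma dom_prefix u u' : v = u ++ u' ->
  dom_v * (word_val iM u * (word_val iM u)^-1) = dom_v.
Proof.
move=> vE; rewrite (idemC invM (idem_mulgV invM _) (idem_mulgV invM _)).
by rewrite {1}vE word_val_cat !mulgA mulgVg // -word_val_cat -vE.
Qed.

(** If the prefixes [u] and [w] end at the same vertex, the value of [u^-1 w] in [Q] is 1, so
    [mulg_quo_idem] applies with [dom_v] as [e]. *)
Lemma reached_uniq k x y : reached k x -> reached k y -> x = y.
Proof.
move=> [u [u' [vEu uk <-]]] [w [w' [vEw wk <-]]].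
apply: (mulg_quo_idem invM (idem_mulgV invM _)).
- exact: dom_prefix vEu.
- exact: dom_prefix vEw.
rewrite -word_val_inv -word_val_cat; apply: hQM.
by rewrite word_val_cat word_val_inv uk wk mulVg.
Qed.

Lemma lift_spanned : word_over spanned (lift iQ 1 v).
Proof.
(* Induction on the suffix [w] still to be read, after the prefix [u]. *)
suff gen u w : v = u ++ w -> word_over spanned (lift iQ (word_val iQ u) w).
  by have := gen [::] v erefl; rewrite word_val_nil.
elim: w u => //= l w IH u.
rewrite -cat_rcons => vE.
have red_l :
    reached (word_val iQ (rcons u l)) (dom_v * word_val iM (rcons u l)).
  by exists (rcons u l), w.
have red : reached (word_val iQ u) (dom_v * word_val iM u).
  by exists u, (l :: w); rewrite vE cat_rcons.
have := dom_prefix vE; rewrite word_val_rcons => /(mulgKV_le invM) lK.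
have := IH _ vE; move: red_l lK; rewrite !word_val_rcons mulgA.
by case: l {vE} => a /= red_l lK -> ; rewrite andbT; apply/mem_set;
  [exists (dom_v * word_val iM u), (dom_v * word_val iM u * iM a)
  |exists (dom_v * word_val iM u * (iM a)^-1), (dom_v * word_val iM u)];
  split=> //=; rewrite ?mulgKV //; rewrite invgK in lK.
Qed.

(** A spanned edge only provides some reached element at its start; [reached_uniq] identifies it
    with the current one. *)
Lemma reached_path k h p x : forms_path iQ k p h -> word_over spanned p ->
  reached k x -> reached h (x * word_val iM (map (@label A Q) p)).
Proof.
elim: p k x => [|l p IH] k x /=.
  by move=> -> _; rewrite word_val_nil mulg1.
move=> [lk /IH {}IH] /andP[/set_mem [y [z [red_y red_z yz zy]]] {}/IH IH] red_x.
rewrite word_val_cons mulgA; apply: IH.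
case: l lk red_y red_z yz zy => [[k' a]|[k' a]] /=;
  rewrite /edge_init /edge_term /= => kE red_y red_z yz zy.
  by rewrite kE in red_y red_z *; rewrite (reached_uniq red_x red_y) yz.
rewrite mulgK; rewrite kE in red_z.
by rewrite (reached_uniq red_x red_z) zy.
Qed.

Lemma spanned_path_le p : forms_path iQ 1 p (word_val iQ v) ->
  word_over spanned p ->
  natural_le (word_val iM v) (word_val iM (map (@label A Q) p)).
Proof.
move=> p_path p_span.
have red1 : reached 1 dom_v by exists [::], v; rewrite !word_val_nil mulg1.
have redv : reached (word_val iQ v) (word_val iM v).
  by exists v, [::]; rewrite cats0 mulgVg.
(* The path leads from [dom_v] (empty prefix) to the value of [v] (full prefix). The idempotent
   [dom_v] is then moved to the right, as [natural_le] demands. *)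
rewrite (reached_uniq redv (reached_path p_path p_span red1)).
rewrite (idem_mulg_conj invM _ (idem_mulgV invM _)).
eexists; last reflexivity.
exact: (idem_conj invM _ (idem_mulgV invM _)).
Qed.

End Prefixes.

(** * Finite supports and content *)

Section Content.
Variables (X : Type) (R : groupType) (i : X -> R).

(** Descent on the size of [s]: a support that is not minimal contains a strictly smaller one,
    obtained by filtering [s]. *)
Lemma min_support_within (g : R) (s : seq {classic X}) :
  supports i g [set` s]%classic ->
  exists2 B, min_support i g B & (B `<=` [set` s])%classic.
Proof.
have [n] := ubnP (size s); elim: n s => // n IH s lt_s_n supp_s.
have [min_s|not_min] := pselect (min_support i g [set` s]%classic).
  by exists [set` s]%classic.
have [B [supp_B sBs neqB]] : exists B : set X, [/\ supports i g B,
    (B `<=` [set` s])%classic & B <> [set` s]%classic].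
  apply: contrapT => none; apply: not_min; split=> // B supp_B sBs.
  by apply: contrapT => neqB; apply: none; exists B.
pose t : seq {classic X} := [seq x <- s | x \in B].
have BE : B = [set` t]%classic.
  apply/seteqP; split=> x /=.
    by move=> Bx; rewrite mem_filter mem_set //; apply: sBs.
  by rewrite mem_filter => /andP[/set_mem].
have lt_t : size t < n.
  apply: leq_trans (_ : size s <= n) => //; rewrite size_filter ltn_neqAle.
  rewrite count_size andbT -all_count; apply/allP => all_B; apply: neqB.
  by apply/seteqP; split=> // x /= /all_B/set_mem.
have [|B' minB' sB'] := IH _ lt_t; first by rewrite -BE.
by exists B' => //; apply: subset_trans sBs; rewrite BE.
Qed.

(** The finitely many letters of [w] contain a minimal support, which is the content by
    uniqueness. *)
Lemma content_sub (C : R -> set X) (B : set X) (w : word X) :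
  content_function i C -> word_over B w -> (C (word_val i w) `<=` B)%classic.
Proof.
move=> contC w_B; pose s : seq {classic X} := map (@letter_base X) w.
have [|B' /(contC _).2 <- sB's] := @min_support_within (word_val i w) s.
  exists w => //; rewrite /s; elim: w {w_B s} => //= l w IH.
  apply/andP; split; first by apply/mem_set; rewrite /= inE eqxx.
  apply: word_over_sub IH => x /= x_w.
  by rewrite inE x_w orbT.
apply: subset_trans sB's _ => x /=; rewrite /s.
elim: w w_B {s} => //= l w IH /andP[/set_mem Bl /IH sB].
by rewrite inE => /predU1P[->|/sB].
Qed.

End Content.

(** * The cover inside [H * M] *)

Section Cover.
Variables (A : Type) (M : finStarMonoidType) (invM : inverse_star_monoid M).
Variable iM : A -> M.
Variables (Q : finGroupType) (iQ : A -> Q).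
Hypothesis hQM : forall w : word A, word_val iQ w = 1 -> idem (word_val iM w).
Variables (G : finGroupType) (iG : Q * A -> G) (C : G -> set (Q * A)).
Variables (act : left_action Q G) (hG : reflects iQ iG act C).
Local Notation S := (coverS iM iQ iG act).
Local Notation valH := (word_val (@iH A Q G iQ iG act)).

Lemma lactV g x : act g x^-1 = (act g x)^-1.
Proof. by apply: (mulgI (act g x)); rewrite -lact_morph !mulgV lact_1. Qed.

(** Acting by [g] translates the lift from 1 to the lift from [g]; a general [g] is needed because
    each letter moves the base vertex. *)
Lemma word_val_semidirect w :
  word_val (gen_val iQ iG act) w =
  (word_val iG (lift iQ 1 w), word_val iQ w) :> semidirect act.
Proof.
suff actE g :
    act g (word_val (gen_val iQ iG act) w).1 = word_val iG (lift iQ g w) /\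
    (word_val (gen_val iQ iG act) w).2 = word_val iQ w.
  by case: (actE 1) => <- <-; rewrite lact1; apply: surjective_pairing.
elim: w g => [|l w IH] g; first by rewrite /= !word_val_nil lact_1.
rewrite !(word_val_cons (gen_val _ _ _)) [word_val iQ _]word_val_cons.
case: l => a /=; rewrite lact_morph -lactM word_val_cons /=.
  have [-> ->] := IH (g * iQ a).
  by rewrite (reflects_act hG) mulg1.
(* The inverse of a generator is twisted by [(iQ a)^-1], matching the shifted edge in the [Neg] case
   of [lift]. *)
have [<- ->] := IH (g * (iQ a)^-1).
by rewrite lactV (reflects_act hG) mulg1 lactM.
Qed.

Lemma sgval_word_val w :
  sgval (valH w) = (word_val iG (lift iQ 1 w), word_val iQ w) :> semidirect act.
Proof.
rewrite -word_val_semidirect; elim: w => [|l w IH].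
  by rewrite !word_val_nil.
by rewrite !word_val_cons /= -IH; case: l.
Qed.

Lemma coverS_word (x : S) : exists w, val x = (valH w, word_val iM w).
Proof. by case: x => x /= /set_mem[w _ <-]; exists w. Qed.

Definition word_coverS (w : word A) : S :=
  exist _ (valH w, word_val iM w) (mem_set (ex_intro2 _ _ w I erefl)).

Lemma word_val1_idem w : valH w = 1 -> idem (word_val iM w).
Proof. by move/(congr1 sgval); rewrite sgval_word_val => -[_ /hQM]. Qed.

(** A group has a single idempotent; conversely, value 1 in [H] forces value 1 in [Q], so [hQM]
    applies. *)
Lemma coverS_idem (x : S) : (val x).1 = 1 <-> idem x.
Proof.
split=> [x1|/(congr1 (fun y => (val y).1))/= xx].
  apply: val_inj; have [w xE] := coverS_word x; move: x1 => /=.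
  rewrite /= xE /= => w1; congr (_, _); first by rewrite w1 mulg1.
  exact: word_val1_idem.
by apply: (mulgI (val x).1); rewrite mulg1.
Qed.

Lemma word_coverS_quo_idem w u : valH w = valH u ->
  idem (word_coverS (word_inv w ++ u)).
Proof.
by move=> wu; apply/coverS_idem; rewrite /= word_val_cat word_val_inv wu mulVg.
Qed.

Lemma coverS_sigma (x y : S) : sigma x y <-> (val x).1 = (val y).1.
Proof.
split=> [[e /coverS_idem e1 /(congr1 (fun z => (val z).1))/=]|xy].
  by move/mulIg.
have [w xE] := coverS_word x; have [u yE] := coverS_word y.
have wu : valH w = valH u by rewrite xE yE in xy.
have e_idem := word_coverS_quo_idem wu.
exists (word_coverS (word_inv w ++ u)) => //.
apply: val_inj; rewrite /= xE yE /=; congr (_, _); first by rewrite wu.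
rewrite /= (word_val_cat iM) word_val_inv; apply: (quo_idem_eq invM).
have := congr1 (fun z => (val z).2) e_idem.
by rewrite /= word_val_cat word_val_inv.
Qed.

Lemma coverS_natural_le (x y : S) : (val x).1 = (val y).1 ->
  natural_le (val x).2 (val y).2 -> natural_le x y.
Proof.
have [w xE] := coverS_word x; have [u yE] := coverS_word y.
rewrite xE yE /= => wu [e e_idem wE].
(* The given [e] need not come from an element of [S]; the value of [u^-1 w] replaces it. *)
exists (word_coverS (word_inv u ++ w)); first exact: word_coverS_quo_idem.
apply: val_inj; rewrite xE /= yE /= !word_val_cat !word_val_inv wu mulVg.
by congr (_, _); rewrite /= ?mulg1 // wE !mulgA mulgVg.
Qed.

Lemma coverS_inverse : inverse_monoid S.
Proof.
move=> x; have [w xE] := coverS_word x.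
exists (word_coverS (word_inv w)); split.
  have [m1 m2] := invM.2 (word_val iM w).
  split; apply: val_inj; rewrite /= xE /= !word_val_inv.
    by congr (_, _); rewrite /= ?mulgV ?mul1g.
  by congr (_, _); rewrite /= ?mulVg ?mul1g.
move=> y [xyx yxy]; apply: val_inj => /=.
have [u yE] := coverS_word y; rewrite yE.
have := congr1 val xyx; have := congr1 val yxy; rewrite /= xE yE.
move=> [_ yxy2] [xyx1 xyx2]; rewrite !word_val_inv; congr (_, _).
  apply: (mulgI (valH w)); rewrite mulgV; apply: (mulIg (valH w)).
  by rewrite xyx1 mul1g.
by apply: inverse_of_uniq invM (word_val iM w) _ _ (invM.2 _) _.
Qed.

Lemma content_path v : exists q : word (Q * A),
  [/\ forms_path iQ 1 q (word_val iQ v),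
      word_val iG q = word_val iG (lift iQ 1 v)
    & word_over (C (word_val iG (lift iQ 1 v))) q].
Proof.
have := lift_path iQ 1 v; rewrite mul1g; set p := lift _ _ _ => p_path.
have [C0|/(reflects_nonempty hG p_path)[q [q_path qE q_C]]] :=
    pselect (C (word_val iG p) = set0); last by exists q.
(* With empty content the path is closed, and its value is that of a word over the empty set, hence
   1. *)
exists [::]; split=> //=; first exact: (reflects_empty hG p_path C0).
have [[[w w_C <-] _] _] := reflects_content hG (word_val iG p).
by case: w w_C => // l w; rewrite C0 /= => /andP[/set_mem].
Qed.

Lemma coverS_F_inverse : F_inverse S.
Proof.
split=> [|x]; first exact: coverS_inverse.
have [v xE] := coverS_word x.
have [q [q_path qE q_C]] := content_path v.
have [liftq vq] := path_lift q_path; rewrite mul1g in vq.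
exists (word_coverS (map (@label A Q) q)).
  apply/coverS_sigma; rewrite xE; apply: val_inj => /=.
  by rewrite !sgval_word_val liftq qE -vq.
move=> y /coverS_sigma; rewrite xE /=; have [u yE] := coverS_word y.
rewrite yE /= => vu.
have := congr1 sgval vu; rewrite !sgval_word_val => -[vuG vuQ].
apply: coverS_natural_le; rewrite yE /=.
  by apply: val_inj; rewrite /= -vu !sgval_word_val liftq qE -vq.
apply: (spanned_path_le invM hQM); first by rewrite -vuQ.
(* The content depends only on the common value in [G], so [q], chosen from [v], serves every [u] in
   the class. *)
rewrite vuG in q_C; apply: word_over_sub q_C.
exact: (content_sub (reflects_content hG) (lift_spanned invM iM iQ u)).
Qed.

Definition coverS_proj (x : S) : M := (val x).2.

Lemma coverS_proj_morph : coverS_proj 1 = 1 /\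
  {morph coverS_proj : x y / x * y}.
Proof. by []. Qed.

HB.instance Definition _ :=
  isUMagmaMorphism.Build S M coverS_proj coverS_proj_morph.

End Cover.

Theorem theorem2p4 (A : Type) (hA : inhabited A)
  (M : finStarMonoidType) (hM : inverse_star_monoid M)
  (iM : A -> M) (hiM : generates iM)
  (Q : finGroupType) (iQ : A -> Q) (hiQ : generates iQ)
  (hQM : forall w : word A, word_val iQ w = 1 -> idem (word_val iM w))
  (G : finGroupType) (iG : Q * A -> G) (hiG : generates iG)
  (C : G -> set (Q * A)) (act : left_action Q G)
  (hG : reflects iQ iG act C) :
  finite_set (subS iM iQ iG act) /\
  F_inverse_cover (coverS iM iQ iG act) M.
Proof.
split; first exact: finite_finset.
split; first exact: coverS_F_inverse hG.
exists (@coverS_proj A M iM Q iQ G iG act); split=> [y|e f].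
  have [w <-] := generates_word_val hiM y.
  by exists (word_coverS iM iQ iG act w).
(* Idempotents have [H]-component 1, so the [M]-component determines them. *)
move=> /(coverS_idem hQM hG) e1 /(coverS_idem hQM hG) f1.
move=> ef; have {}ef : (val e).2 = (val f).2 by [].
apply: val_inj.
by rewrite [val e]surjective_pairing e1 ef -f1 -surjective_pairing.
Qed.
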